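(* For every integer $k \ge 1$, every outer min-$k$-planar graph has treewidth at most $3k+1$.
   Context: A convex drawing of a finite simple graph $G$ places the vertices of $G$ at distinct points of a circle and draws every edge as a straight-line segment. A convex drawing is outer min-$k$-planar if for every pair of crossing edges, at least one of the two edges is crossed by at most $k$ edges in total. A graph is outer min-$k$-planar if it admits an outer min-$k$-planar drawing. *)

(* Defs.v *)
From mathcomp Require Import all_boot all_order all_algebra.
From mathcomp Require Import boolp classical_sets reals.

Set Implicit Arguments.
Unset Strict Implicit.
Unset Printing Implicit Defensive.

Import Order.TTheory GRing.Theory Num.Theory.

Local Open Scope ring_scope.

Record sgraph := SGraph {
  vertex :> finType;
  adj : rel vertex;
  adj_sym : symmetric adj;
  adj_irr : irreflexive adj }.

Definition edges (G : sgraph) : {set {set G}} :=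
  [set [set p.1; p.2] | p : G * G & adj p.1 p.2].

Section Drawing.
Variables (R : realType) (G : sgraph).
Implicit Types (pos : G -> 'rV[R]_2) (E F : {set G}).

Definition on_circle (c : 'rV[R]_2) (r : R) (p : 'rV[R]_2) : Prop :=
  \sum_(i < 2) (p 0 i - c 0 i) ^+ 2 = r ^+ 2.

Definition convex_drawing pos : Prop :=
  injective pos /\
  exists c r, 0 < r /\ forall v, on_circle c r (pos v).

Definition open_segment (p q : 'rV[R]_2) : set 'rV[R]_2 :=
  [set z | exists t : R, 0 < t < 1 /\ z = (1 - t) *: p + t *: q].

(* Endpoints are excluded, so that adjacent edges do not meet at their common
   endpoint. *)
Definition edge_interior pos E : set 'rV[R]_2 :=
  [set z | exists u v, E = [set u; v]%SET /\ open_segment (pos u) (pos v) z].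

Definition crossing pos E F : Prop :=
  E <> F /\ exists z, edge_interior pos E z /\ edge_interior pos F z.

Definition crossing_number pos E : nat :=
  #|[set F in edges G | `[< crossing pos E F >]]|.

Definition outer_min_planar_drawing (k : nat) pos : Prop :=
  convex_drawing pos /\
  forall E F, E \in edges G -> F \in edges G -> crossing pos E F ->
    (crossing_number pos E <= k)%N \/ (crossing_number pos F <= k)%N.

Definition outer_min_planar (k : nat) : Prop :=
  exists pos, outer_min_planar_drawing k pos.

End Drawing.

Definition connected_graph (G : sgraph) : Prop :=
  forall x y : G, connect (@adj G) x y.

(* [ucycle] also accepts the empty sequence and the back-and-forth walk along
   one edge, whence the bound on the size. *)
Definition acyclic_graph (G : sgraph) : Prop :=
  forall s : seq G, ucycle (@adj G) s -> (size s < 3)%N.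

Definition is_tree (G : sgraph) : Prop :=
  [/\ (0 < #|G|)%N, connected_graph G & acyclic_graph G].

Definition tree_decomposition (G H : sgraph) (B : H -> {set G}) : Prop :=
  [/\ is_tree H,
      forall v : G, exists i, v \in B i,
      forall u v : G, adj u v -> exists i, u \in B i /\ v \in B i
    & forall (v : G) (i j : H), v \in B i -> v \in B j ->
        connect [rel x y | [&& adj x y, v \in B x & v \in B y]] i j].

(* Predecessor is truncated: if all bags are empty the width is 0, not -1. *)
Definition width (G H : sgraph) (B : H -> {set G}) : nat :=
  (\max_(i : H) #|B i|).-1.

Definition decomposition_width (G : sgraph) (w : nat) : Prop :=
  exists (H : sgraph) (B : H -> {set G}),
    tree_decomposition B /\ width B = w.

Lemma ex_decomposition_width (G : sgraph) :
  exists w, `[< decomposition_width G w >].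
Proof.
have sym1 : symmetric (fun _ _ : unit => false) by [].
have irr1 : irreflexive (fun _ _ : unit => false) by [].
exists (width (H := SGraph sym1 irr1) (fun=> [set: G]%SET)).
apply/asboolP; exists (SGraph sym1 irr1), (fun=> [set: G]%SET); split=> //.
split.
- split; first by rewrite card_unit.
  + by case=> [] []; exact: connect0.
  + by case=> [|x [|y s]].
- by move=> v; exists tt; rewrite inE.
- by move=> u v _; exists tt; rewrite !inE.
- by move=> v [] [] _ _; exact: connect0.
Qed.

Definition treewidth (G : sgraph) : nat := ex_minn (ex_decomposition_width G).

(* Main.v *)
(* Ordering the vertices along the circle turns crossing into interleaving of
   ranks.  Starting from the chord joining the first and the last vertex, split
   each chord ab at a vertex c between a and b into the chords ac and cb, always
   keeping every chord crossed by at most 2k - 1 edges, and at most k edges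
   going from [a, c) to (c, b).  The bag of the triangle acb consists of a, b, c,
   the larger endpoint of each edge crossing ab, and the larger endpoint of each
   edge from [a, c) to (c, b), hence has at most 3 + (2k - 1) + k elements.

   To find c when ab is crossed, take an edge crossing ab whose endpoint c
   between a and b is a median of all such endpoints, so that at most k - 1 of
   the edges crossing ab end on each side of c.  If this edge has at most k
   crossings, c works.  Otherwise every edge within [a, b] that passes over c
   crosses it and so has at most k crossings, and an endpoint of an extremal
   such edge works (or c, if there is none). *)

Require Import Defs.
From mathcomp Require Import all_boot all_order all_algebra ring lra zify.
From mathcomp Require Import boolp reals.

Set Implicit Arguments.
Unset Strict Implicit.
Unset Printing Implicit Defensive.

Import Order.TTheory GRing.Theory Num.Theory.

(** * Choice of the vertex that splits a chord *)

Lemma median (T : finType) (X : {set T}) (f : T -> nat) (m : nat) :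
  X != set0 -> #|X| <= m.*2.+1 ->
  exists e, [/\ e \in X, #|[set x in X | f x < f e]| <= m
                       & #|[set x in X | f e < f x]| <= m].
Proof.
move=> /set0Pn[x0 x0X] cardX.
pose few x := (x \in X) && (#|[set y in X | f x < f y]| <= m).
have [x1 x1X x1max] := @arg_maxnP _ x0 (fun x => x \in X) f x0X.
have few1 : few x1.
  rewrite /few x1X; apply: (@leq_trans 0) => //; rewrite leqn0 cards_eq0.
  apply/eqP/setP => y; rewrite !inE; apply/negP => /andP[yX].
  by rewrite ltnNge (x1max _ yX : f y <= f x1).
(* [e] is a lowest element with at most [m] above it. If more than [m] lay below it, a highest one
   [y] of those would by minimality have more than [m] above, and these two disjoint sets would
   together exceed [2m + 1]. *)
have [e /andP[eX eR] emin] := @arg_minnP _ x1 few f few1.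
exists e; split=> //; rewrite leqNgt; apply/negP => eL.
have /set0Pn[y0 y0L] : [set x in X | f x < f e] != set0.
  by rewrite -card_gt0; apply: leq_trans eL.
have [y yL ymax] := @arg_maxnP _ y0
  (fun y => y \in [set x in X | f x < f e]) f y0L.
have := yL; rewrite inE => /andP[yX yltE].
have yR : m < #|[set x in X | f y < f x]|.
  rewrite ltnNge; apply/negP => yfew.
  by have := emin y; rewrite /few yX yfew => /(_ isT); rewrite leqNgt yltE.
have dis : [disjoint [set x in X | f x < f e] & [set x in X | f y < f x]].
  rewrite disjoints_subset; apply/subsetP => z zL.
  by rewrite !inE negb_and -leqNgt; apply/orP; right; exact: ymax.
have : #|[set x in X | f x < f e] :|: [set x in X | f y < f x]| <= #|X|.
  by apply/subset_leq_card/subsetP => z; rewrite !inE => /orP[] /andP[].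
rewrite cardsU (disjoint_setI0 dis) cards0 subn0; move: eL yR cardX; lia.
Qed.

Section Split.
Variables (G : sgraph) (r : G -> nat).
Hypothesis r_inj : injective r.

(* Pairs are ordered by rank, so that every edge is counted once. *)
Definition crossers (u v : G) : {set G * G} :=
  [set e : G * G | adj e.1 e.2
     & [&& r u < r e.1, r e.1 < r v & r v < r e.2]
       || [&& r e.1 < r u, r u < r e.2 & r e.2 < r v]].

Definition spanners (a c b : G) : {set G * G} :=
  [set e : G * G | adj e.1 e.2 & (r a <= r e.1 < r c) && (r c < r e.2 < r b)].

(** For [i] and [j] between the ranks of [a] and [b], only the endpoint of a crossing edge that lies
    inside the chord can fall into the range. *)
Definition crossers_from (a b : G) (i j : nat) : {set G * G} :=
  [set e in crossers a b | (i < r e.1 < j) || (i < r e.2 < j)].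

Variable k : nat.
Hypothesis k_gt0 : 0 < k.
Hypothesis min_k : forall u v p q : G, adj u v -> adj p q ->
  r u < r p < r v -> r v < r q -> #|crossers u v| <= k \/ #|crossers p q| <= k.

Lemma heavy_noncrossing (u v p q : G) : adj u v -> adj p q ->
  k < #|crossers u v| -> k < #|crossers p q| ->
  ~~ [&& r u < r p, r p < r v & r v < r q].
Proof.
move=> uv pq huv hpq; apply/negP => /and3P[up pv vq].
by have [] := min_k uv pq (introT andP (conj up pv)) vq; lia.
Qed.

Definition good_split (a c b : G) : Prop :=
  [/\ r a < r c < r b, #|crossers a c| < k.*2, #|crossers c b| < k.*2
    & #|spanners a c b| <= k].

Lemma card_crossers_le (X A B : {set G * G}) :
  X \subset A :|: B -> #|A| < k -> #|B| <= k -> #|X| < k.*2.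
Proof. move=> /subset_leq_card; rewrite cardsU; lia. Qed.

(** An edge crossing a new chord either crosses [ab] with its inner end on one given side of [c], or
    crosses one chosen light edge over [c]; spanners all cross the light edge. The disjunction
    exempts the edge [ab], which may be heavy. *)
Lemma good_split_pivot (a c b : G) :
  r a < r c < r b ->
  (forall p q, adj p q -> r a <= r p < r c -> r c < r q <= r b ->
     (r a < r p) || (r q < r b) -> #|crossers p q| <= k) ->
  #|crossers_from a b (r a) (r c)| < k ->
  #|crossers_from a b (r c) (r b)| < k ->
  exists c', good_split a c' b.
Proof.
move=> acb light cntL cntR.
(* The edge from [a] over [c] that reaches farthest below [b] is light; no edge from [a] ends
   between its endpoint [v] and [b], so [v] splits. *)
have [/existsP[v0 v0P] | /existsPn no_a] :=
  boolP [exists v, adj a v && (r c < r v < r b)].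
  have [v /andP[adj_av v_in] vmax] := @arg_maxnP _ v0
    (fun v => adj a v && (r c < r v < r b)) r v0P.
  have Xav : #|crossers a v| <= k by apply: light => //; lia.
  exists v; split; [lia | lia | |].
  - apply: (card_crossers_le _ cntR Xav).
    apply/subsetP => -[p q]; rewrite !inE /= => /andP[pq H]; rewrite pq /=.
    have := vmax q; case: (r p =P r a) => [/r_inj pa|]; first rewrite -pa pq.
      by subst p; lia.
    by move: H; clear -v_in acb; lia.
  - apply: leq_trans Xav; apply/subset_leq_card/subsetP => -[p q].
    rewrite !inE /= => /andP[pq H]; rewrite pq /=.
    have := vmax q; case: (r p =P r a) => [/r_inj pa|]; first rewrite -pa pq.
      by subst p; lia.
    by move: H; clear -v_in acb; lia.
(* Otherwise the edge over [c] with lowest start [u] above [a] is light and [u] splits; edges over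
   [c] starting at [a] are excluded by [no_a]. *)
have [/existsP[f0 f0P] | /existsPn no_span] :=
  boolP [exists f : G * G, adj f.1 f.2 && (r a < r f.1 < r c) &&
           (r c < r f.2 <= r b)].
  have [[u v] /= /andP[/andP[adj_uv u_in] v_in] umin] := @arg_minnP _ f0
    (fun f => adj f.1 f.2 && (r a < r f.1 < r c) && (r c < r f.2 <= r b))
    (fun f => r f.1) f0P.
  have Xuv : #|crossers u v| <= k by apply: light => //; lia.
  exists u; split; [lia | | |].
  - apply: (card_crossers_le _ cntL Xuv).
    apply/subsetP => -[p q]; rewrite !inE /= => /andP[pq H]; rewrite pq /=.
    by have := umin (p, q); rewrite /= pq; lia.
  - apply: (card_crossers_le _ cntR Xuv).
    apply/subsetP => -[p q]; rewrite !inE /= => /andP[pq H]; rewrite pq /=.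
    have := umin (p, q); rewrite /= pq; have := no_a q.
    case: (r p =P r a) => [/r_inj pa|]; first by rewrite -pa pq /=; subst p; lia.
    by move: H; lia.
  - apply: leq_trans Xuv; apply/subset_leq_card/subsetP => -[p q].
    rewrite !inE /= => /andP[pq H]; rewrite pq /=.
    have := umin (p, q); rewrite /= pq; have := no_a q.
    case: (r p =P r a) => [/r_inj pa|]; first by rewrite -pa pq /=; subst p; lia.
    by move: H; lia.
(* No edge within [[a, b]] except possibly [ab] passes over [c]: every edge crossing [ac] or [cb]
   crosses [ab], and there are no spanners. *)
exists c; split=> //.
- apply: leq_ltn_trans (_ : k.-1 < _); last lia.
  apply: leq_trans (_ : #|crossers_from a b (r a) (r c)| <= _); last lia.
  apply/subset_leq_card/subsetP => -[p q]; rewrite !inE /= => /andP[pq H].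
  by have := no_span (p, q); rewrite /= pq; lia.
- apply: leq_ltn_trans (_ : k.-1 < _); last lia.
  apply: leq_trans (_ : #|crossers_from a b (r c) (r b)| <= _); last lia.
  apply/subset_leq_card/subsetP => -[p q]; rewrite !inE /= => /andP[pq H].
  have := no_span (p, q); rewrite /= pq; have := no_a q.
  by case: (r p =P r a) => [/r_inj pa|]; first (rewrite -pa pq /=; subst p); lia.
- apply: (@leq_trans 0) => //; rewrite leqn0 cards_eq0.
  apply/eqP/setP => -[p q]; rewrite !inE /=; apply/negP => /andP[pq H].
  have := no_span (p, q); rewrite /= pq; have := no_a q.
  by case: (r p =P r a) => [/r_inj pa|]; first (rewrite -pa pq /=; subst p); lia.
Qed.

(** The pivot is an endpoint of a longest heavy edge within [[a, b]] other than [ab]: a heavy edge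
    over it would cross that edge, against [heavy_noncrossing], or enclose it and be longer. Without
    heavy edges any inner vertex serves. *)
Lemma good_split_uncrossed (a i b : G) :
  r a < r i < r b -> crossers a b = set0 -> exists c, good_split a c b.
Proof.
move=> aib X0.
have cnt j l : #|crossers_from a b j l| < k.
  by rewrite /crossers_from X0 (_ : [set _ in _ | _] = set0) ?cards0 //;
     apply/setP => e; rewrite !inE.
pose heavy (f : G * G) := [&& adj f.1 f.2, r a <= r f.1, r f.1 < r f.2,
  r f.2 <= r b, (r a < r f.1) || (r f.2 < r b) & k < #|crossers f.1 f.2|].
have [/existsP[f0 f0P] | /existsPn no_heavy] := boolP [exists f, heavy f].
  have [[u v] /= /and5P[/= uv au ltuv vb /andP[nab hv]] fmax] :=
    @arg_maxnP _ f0 heavy (fun f => r f.2 - r f.1) f0P.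
  apply: (@good_split_pivot a (if r a < r u then u else v) b) => //.
    by case: ifP; lia.
  move=> p q pq p_in q_in nab'; rewrite leqNgt; apply/negP => hpq.
  have : r q - r p <= r v - r u.
    by apply: (fmax (p, q)); rewrite /heavy /= pq hpq nab' andbT; lia.
  have := heavy_noncrossing uv pq hv hpq.
  have := heavy_noncrossing pq uv hpq hv.
  by case: ifP p_in q_in; lia.
apply: (@good_split_pivot a i b) => // p q pq p_in q_in nab.
by have := no_heavy (p, q); rewrite /heavy /= pq nab; lia.
Qed.

Lemma good_split_crossed (a b : G) :
  r a < r b -> crossers a b != set0 -> #|crossers a b| < k.*2 ->
  exists c, good_split a c b.
Proof.
move=> ab X0 cX.
pose inner (e : G * G) := if r a < r e.1 then e.1 else e.2.
(* The median bound is [k.-1] because [2k - 1 = 2(k - 1) + 1]. *)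
have [|[u v] [eX cntL' cntR']] := @median _ _ (fun e => r (inner e)) k.-1 X0.
  by rewrite -ltnS; apply: leq_trans cX _; lia.
have Lsub c : inner (u, v) = c -> #|crossers_from a b (r a) (r c)| < k.
  move=> <-; apply: leq_ltn_trans (_ : k.-1 < k); last lia.
  apply: leq_trans cntL'; apply/subset_leq_card/subsetP => -[p q].
  by rewrite !inE /inner /=; case: (ltnP (r a) (r p)); case: (ltnP (r a) (r u)) => /=; lia.
have Rsub c : inner (u, v) = c -> #|crossers_from a b (r c) (r b)| < k.
  move=> <-; apply: leq_ltn_trans (_ : k.-1 < k); last lia.
  apply: leq_trans cntR'; apply/subset_leq_card/subsetP => -[p q].
  by rewrite !inE /inner /=; case: (ltnP (r a) (r p)); case: (ltnP (r a) (r u)) => /=; lia.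
move: eX; rewrite inE /= => /andP[uv uvX].
have [c cE] : exists c, c = inner (u, v) by exists (inner (u, v)).
have {}Lsub := Lsub c (esym cE); have {}Rsub := Rsub c (esym cE).
rewrite /inner /= in cE.
have acb : r a < r c < r b by rewrite cE; case: ifP; lia.
(* The edge [uv] leaves [[a, b]] from [c], so it crosses every edge within [[a, b]] that passes over
   [c]. If [uv] is heavy, all these are light; if it is light, its crossings bound their number. *)
have [light|heavy] := leqP #|crossers u v| k; last first.
  apply: (@good_split_pivot a c b); [by []| |by []|by []].
  move=> p q pq p_in q_in _; rewrite leqNgt; apply/negP => hpq.
  have := heavy_noncrossing uv pq heavy hpq.
  have := heavy_noncrossing pq uv hpq heavy.
  by move: cE p_in q_in; case: ifP => ru ->; lia.
exists c; split=> //.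
- apply: (card_crossers_le _ Lsub light).
  apply/subsetP => -[p q]; rewrite !inE /= => /andP[pq H]; rewrite pq /=.
  by move: cE acb H; case: ifP => ru ->; lia.
- apply: (card_crossers_le _ Rsub light).
  apply/subsetP => -[p q]; rewrite !inE /= => /andP[pq H]; rewrite pq /=.
  by move: cE acb H; case: ifP => ru ->; lia.
- apply: leq_trans light; apply/subset_leq_card/subsetP => -[p q].
  rewrite !inE /= => /andP[pq H]; rewrite pq /=.
  by move: cE acb H; case: ifP => ru ->; lia.
Qed.

Lemma good_split_exists (a i b : G) :
  r a < r i < r b -> #|crossers a b| < k.*2 -> exists c, good_split a c b.
Proof.
move=> aib cX; have [X0|X0] := eqVneq (crossers a b) set0.
  exact: good_split_uncrossed aib X0.
by apply: good_split_crossed => //; lia.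
Qed.

End Split.

(** * Trees of bags, grown leaf by leaf *)

Section AddLeaf.
Variables (H : sgraph) (j : H).

Definition leaf_adj (x y : option H) : bool :=
  match x, y with
  | Some x, Some y => adj x y
  | Some x, None => x == j
  | None, Some y => y == j
  | None, None => false
  end.

Lemma leaf_adj_sym : symmetric leaf_adj.
Proof. by case=> [x|] [y|] //=; exact: adj_sym. Qed.

Lemma leaf_adj_irr : irreflexive leaf_adj.
Proof. by case=> [x|] //=; exact: adj_irr. Qed.

Definition add_leaf : sgraph := SGraph leaf_adj_sym leaf_adj_irr.

(** The relations are arbitrary so as to cover both the whole tree and the nodes whose bags contain
    a given vertex. *)
Lemma connect_add_leaf (e : rel H) (e' : rel (option H)) x y :
  (forall u v, e u v -> e' (Some u) (Some v)) ->
  connect e x y -> connect e' (Some x) (Some y).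
Proof.
move=> ee' /connectP[p + ->]; elim: p x => [|z p IH] x /=; first by rewrite connect0.
by move=> /andP[/ee' xz /IH]; exact/connect_trans/connect1.
Qed.

(** A cycle of length at least 3 through [None] would enter and leave it through [j], visiting [j]
    twice; a cycle avoiding [None] lies in [H]. *)
Lemma is_tree_add_leaf : is_tree H -> is_tree add_leaf.
Proof.
case=> _ conH acH; split; first by apply/card_gt0P; exists None.
- have toj x : connect (@adj add_leaf) x (Some j).
    case: x => [x|]; last by apply: connect1; rewrite /= eqxx.
    exact: (@connect_add_leaf (@adj H) (@adj add_leaf)).
  move=> x y; apply: connect_trans (toj x) _.
  by rewrite (@sym_connect_sym add_leaf _ leaf_adj_sym); exact: toj.
- move=> s cyc_s; have [sN|sN] := boolP (None \in s).
    have [i s' Es] := rot_to sN.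
    have : ucycle (@adj add_leaf) (None :: s') by rewrite -Es rot_ucycle.
    rewrite -(size_rot i) Es => /andP[].
    case: s' {Es} => [|x s']; first by [].
    rewrite /= rcons_path; case/lastP: s' => [|s' y]; first by [].
    rewrite last_rcons.
    case: x => [x|] //=; case: y => [y|] /=; last by case/and3P.
    move=> /and3P[/eqP-> _ /eqP->].
    by rewrite mem_rcons !inE eqxx /= !andbF.
have [s0 Es] : exists s0, s = map Some s0.
  elim: s sN {cyc_s} => [|[x|] s IH]; first by exists [::].
    by rewrite inE => /= /IH[s0 ->]; exists (x :: s0).
  by rewrite inE.
rewrite Es size_map; apply: acH; move: cyc_s.
rewrite Es /ucycle map_inj_uniq; last by move=> ? ? [].
case/andP=> + ->; rewrite andbT; case: (s0) => [//|x p] /=.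
by rewrite -map_rcons path_map.
Qed.

End AddLeaf.

Section BagTree.
Variable T : finType.

(** Only the bags are recorded, latest first; the tree is implicit, each new bag [B] being hung as a
    leaf on [C]. The side condition keeps the nodes of each vertex connected. *)
Inductive bag_tree : seq {set T} -> Prop :=
| bag_root B : bag_tree [:: B]
| bag_leaf s (B C : {set T}) : bag_tree s -> C \in s ->
    (forall v D, D \in s -> v \in D -> v \in B -> v \in C) ->
    bag_tree (B :: s).

Lemma bag_tree_is_tree (t : seq {set T}) : bag_tree t ->
  exists (H : sgraph) (B : H -> {set T}),
    [/\ is_tree H, forall D, D \in t <-> exists i, B i = D
      & forall v i j, v \in B i -> v \in B j ->
          connect [rel x y | [&& adj x y, v \in B x & v \in B y]] i j].
Proof.
elim=> [B|s B C _ [H [BH [treeH sBH conH]]] Cs attach].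
  exists (SGraph (fun _ _ : unit => erefl false) (fun=> erefl)), (fun=> B).
  split; [split| |].
  - by rewrite card_unit.
  - by case=> [] []; exact: connect0.
  - by case=> [|x [|y s]].
  - by move=> D; rewrite inE; split=> [/eqP->|[_ ->]] //; exists tt.
  - by move=> v [] [] _ _; exact: connect0.
have [j Bj] := (sBH C).1 Cs.
pose BH' (x : add_leaf j) := if x is Some i then BH i else B.
exists (add_leaf j), BH'; split; first exact: is_tree_add_leaf.
- move=> D; rewrite inE; split=> [/orP[/eqP->|/sBH[i <-]]|].
  + by exists None.
  + by exists (Some i).
  + move=> [[i|] <-] /=; last by rewrite eqxx.
    by apply/orP; right; apply/sBH; exists i.
move=> v; set e := [rel x y | _].
have e_sym : symmetric e by move=> x y; rewrite /= leaf_adj_sym andbA andbAC -andbA.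
have up x y : v \in BH x -> v \in BH y -> connect e (Some x) (Some y).
  by move=> vx vy; apply: connect_add_leaf (conH v x y vx vy).
have vjP x : v \in BH x -> v \in B -> v \in BH j.
  by move=> vx vB; rewrite Bj; apply: (attach v (BH x)) => //; apply/sBH; exists x.
have toN x : v \in BH x -> v \in B -> connect e (Some x) None.
  move=> vx vB; have vj := vjP x vx vB.
  apply: connect_trans (up x j vx vj) (connect1 _).
  by rewrite /= eqxx vj vB.
case=> [x|] [y|] //= vx vy.
- exact: up.
- exact: toN.
- by rewrite (sym_connect_sym e_sym); exact: toN.
Qed.

End BagTree.

Lemma treewidth_le_bag_tree (G : sgraph) (s : seq {set G}) (w : nat) :
  bag_tree s ->
  (forall v : G, exists2 B, B \in s & v \in B) ->
  (forall u v : G, adj u v -> exists2 B, B \in s & (u \in B) && (v \in B)) ->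
  (forall B, B \in s -> #|B| <= w.+1) ->
  treewidth G <= w.
Proof.
move=> /bag_tree_is_tree[H [B [treeH sB conB]]] cov_v cov_e size_s.
rewrite /treewidth; case: ex_minnP => m _ min_m.
apply: (@leq_trans (width B)).
  apply: min_m; apply/asboolP; exists H, B; split=> //; split=> //.
  - by move=> v; have [_ /sB[i <-] vi] := cov_v v; exists i.
  - by move=> u v /cov_e[_ /sB[i <-] /andP[ui vi]]; exists i.
rewrite /width -subn1 leq_subLR add1n; apply/bigmax_leqP => i _.
by apply: size_s; apply/sB; exists i.
Qed.

(** * Tree decomposition by recursive splitting of chords *)

Section Refine.
Variables (G : sgraph) (r : G -> nat) (k : nat).
Hypothesis r_inj : injective r.
Hypothesis k_gt0 : 0 < k.
Hypothesis min_k : forall u v p q : G, adj u v -> adj p q ->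
  r u < r p < r v -> r v < r q ->
  #|crossers r u v| <= k \/ #|crossers r p q| <= k.

(* Every crossing edge is represented by its endpoint of larger rank, the same
   one for all chords, so that the bags containing a given vertex are connected. *)
Definition heads (a b : G) : {set G} := [set e.2 | e in crossers r a b].

Definition split_bag (a c b : G) : {set G} :=
  [set a; c; b] :|: heads a b :|: [set e.2 | e in spanners r a c b].

Lemma headsP a b q :
  reflect (exists2 p, adj p q & [&& r a < r p, r p < r b & r b < r q]
                                || [&& r p < r a, r a < r q & r q < r b])
          (q \in heads a b).
Proof.
apply: (iffP imsetP) => [[[p x]]|[p pq H]].
  by rewrite inE => /andP[/= pq H] ->; exists p.
by exists (p, q) => //; rewrite inE pq.
Qed.

Lemma split_bagP a c b q :
  reflect [\/ [\/ q = a, q = c | q = b], q \in heads a b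
            | exists2 p, adj p q & (r a <= r p < r c) && (r c < r q < r b)]
          (q \in split_bag a c b).
Proof.
apply: (iffP idP) => [|H].
  rewrite !inE => /orP[/orP[/orP[/orP[]|]|]|].
  - by move/eqP=> ->; constructor 1; constructor 1.
  - by move/eqP=> ->; constructor 1; constructor 2.
  - by move/eqP=> ->; constructor 1; constructor 3.
  - by constructor 2.
  - move=> /imsetP[[p x]]; rewrite inE => /andP[/= px H] ->.
    by constructor 3; exists p.
rewrite !inE; case: H => [[->|->|->]|->|[p pq H]]; rewrite ?eqxx ?orbT //.
by apply/orP; right; apply/imsetP; exists (p, q) => //; rewrite inE pq.
Qed.

Lemma card_split_bag a c b :
  #|crossers r a b| < k.*2 -> #|spanners r a c b| <= k ->
  #|split_bag a c b| <= 3 * k + 2.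
Proof.
move=> cX cW; rewrite /split_bag.
have h1 : #|heads a b| < k.*2 := leq_ltn_trans (leq_imset_card _ _) cX.
have h2 := leq_trans (leq_imset_card (fun e => e.2) (spanners r a c b)) cW.
have h3 : #|[set a; c; b]| <= 3.
  by rewrite !cardsU !cards1; lia.
rewrite cardsU; apply: leq_trans (leq_subr _ _) _.
rewrite cardsU; apply: (@leq_trans (3 + k.*2.-1 + k)); last lia.
apply: leq_add => //; apply: leq_trans (leq_subr _ _) _; apply: leq_add => //.
lia.
Qed.

(* The time taken by [lia] grows exponentially with the boolean hypotheses about
   sets and edges, which are irrelevant to the goals on ranks. *)
Ltac rank_lia :=
  repeat match goal with
  | H : is_true (_ \in _) |- _ => clear H
  | H : is_true (adj _ _) |- _ => clear H
  | H : is_true (#|_| < _) |- _ => clear H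
  | H : is_true (#|_| <= _) |- _ => clear H
  | H : is_true (_ \subset _) |- _ => clear H
  | H : forall _, _ |- _ => clear H
  end; lia.

(** The bags for the chord [ab] are grown from [B]. By the last hypothesis, vertices inside the
    chord that already occur are heads, hence in [B]; the third conclusion restores this for the
    next chord. Edges from [a] to [b] or beyond are left to the caller. *)
Lemma refine_chord (a b : G) (s : seq {set G}) (B : {set G}) :
  bag_tree s -> (forall D, D \in s -> #|D| <= 3 * k + 2) ->
  #|crossers r a b| < k.*2 ->
  B \in s -> a \in B -> b \in B -> heads a b \subset B ->
  (forall D v, D \in s -> v \in D -> r a < r v < r b -> v \in heads a b) ->
  exists t : seq {set G},
    [/\ bag_tree t /\ {subset s <= t},
        forall D, D \in t -> #|D| <= 3 * k + 2,
        forall D v, D \in t -> v \in D ->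
          r a < r v < r b \/ exists2 D', D' \in s & v \in D',
        forall v, r a < r v < r b -> exists2 D, D \in t & v \in D
      & forall p q, adj p q -> r p < r q -> r a <= r p < r b ->
          (r a < r p) || (r q < r b) -> exists2 D, D \in t & (p \in D) && (q \in D)].
Proof.
have [n] := ubnP (r b - r a); elim: n => // n IH in a b s B * => lt_n.
move=> bt_s size_s cX Bs aB bB hB known.
have [/existsP[i aib]|/existsPn empty] := boolP [exists i, r a < r i < r b];
    last first.
  exists s; split=> //; first by split.
  - by move=> D v Ds vD; right; exists D.
  - by move=> v; rewrite (negPf (empty v)).
  - by move=> p q pq; have := empty p; have := empty q; rank_lia.
have [c [acb cX1 cX2 cW]] := good_split_exists r_inj k_gt0 min_k aib cX.
set T := split_bag a c b.
have aT : a \in T by apply/split_bagP; constructor 1; constructor 1.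
have cT : c \in T by apply/split_bagP; constructor 1; constructor 2.
have bT : b \in T by apply/split_bagP; constructor 1; constructor 3.
have hT q : q \in heads a b -> q \in T by move=> ?; apply/split_bagP; constructor 2.
have wT p q : adj p q -> r a <= r p < r c -> r c < r q < r b -> q \in T.
  by move=> pq H H'; apply/split_bagP; constructor 3; exists p; rewrite ?H.
(* A vertex of [T] that occurs earlier lies in [B]: inside the chord by [known], outside it because
   it is [a], [b] or a head of [ab]. *)
have bt1 : bag_tree (T :: s).
  apply: bag_leaf bt_s Bs _ => v D Ds vD.
  have inB : r a < r v < r b -> v \in B.
    by move=> H; apply: (subsetP hB); exact: known Ds vD H.
  have [vin|vout] := boolP (r a < r v < r b); first by move=> _; exact: inB.
  move=> /split_bagP[[->|E|->]|/(subsetP hB)|[p _ H]] //.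
    by move: vout; rewrite E; rank_lia.
  by rank_lia.
have size1 D : D \in T :: s -> #|D| <= 3 * k + 2.
  by rewrite inE => /predU1P[->|/size_s//]; exact: card_split_bag.
have [||D v|t1 [[bt_t1 st1] size_t1 new1 cov1 edge1]] :=
    IH a c (T :: s) T _ bt1 size1 cX1 (mem_head _ _) aT cT.
- rank_lia.
- apply/subsetP => q /headsP[p pq H].
  have [qb|qb] := ltnP (r q) (r b).
    have [qc|qc] := ltnP (r c) (r q); first by apply: wT pq _ _; rank_lia.
    by apply: hT; apply/headsP; exists p => //; rank_lia.
  have [/r_inj->//|qb'] := eqVneq (r q) (r b).
  by apply: hT; apply/headsP; exists p => //; rank_lia.
- have sub q : q \in heads a b -> r a < r q < r c -> q \in heads a c.
    by move=> /headsP[p pq H] H'; apply/headsP; exists p => //; rank_lia.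
  rewrite inE => /predU1P[->|Ds] vD av; last first.
    by apply: sub => //; apply: known Ds vD _; rank_lia.
  case/split_bagP: vD av => [[->|->|->]|vh|[p _ H]] av; try rank_lia.
  exact: sub.
have T1 : T \in t1 by apply: st1; rewrite mem_head.
(* The left half introduces only vertices between [a] and [c], so those present between [c] and [b]
   come from [s] or [T]; upper ends of spanners are now heads of [cb]. *)
have [||D v|t [[bt_t st] size_t new cov edge]] :=
    IH c b t1 T _ bt_t1 size_t1 cX2 T1 cT bT.
- rank_lia.
- apply/subsetP => q /headsP[p pq H].
  have [pa|pa] := ltnP (r p) (r a).
    by apply: hT; apply/headsP; exists p => //; rank_lia.
  have [qb|qb] := ltnP (r q) (r b); first by apply: wT pq _ _; rank_lia.
  by apply: hT; apply/headsP; exists p => //; rank_lia.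
- have sub q : q \in heads a b -> r c < r q < r b -> q \in heads c b.
    by move=> /headsP[p pq H] H'; apply/headsP; exists p => //; rank_lia.
  move=> Dt1 vD cv; have [|[D' + vD']] := new1 D v Dt1 vD; first rank_lia.
  rewrite inE => /predU1P[ED|Ds]; last first.
    by apply: sub => //; apply: known Ds vD' _; rank_lia.
  move: vD'; rewrite ED => /split_bagP[[E|E|E]|vh|[p pq H]].
  + by move: cv; rewrite E; rank_lia.
  + by move: cv; rewrite E; rank_lia.
  + by move: cv; rewrite E; rank_lia.
  + exact: sub.
  + by apply/headsP; exists p => //; rank_lia.
exists t; split=> //; first by split=> // D Ds; apply/st/st1; rewrite inE Ds orbT.
- move=> D v /new /[apply] -[|[D' /new1 /[apply] -[|[D'' + vD'']]]].
  + by left; rank_lia.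
  + by left; rank_lia.
  rewrite inE => /predU1P[ED|Ds]; last by right; exists D''.
  have old : v \in B -> exists2 D', D' \in s & v \in D' by exists B.
  move: vD''; rewrite ED => /split_bagP[[->|->|->]|/(subsetP hB)/old|[p _ H]];
    by [left; rank_lia|right => //; exists B].
- move=> v avb; have [vc|vc] := ltnP (r v) (r c).
    by have [D Dt1 vD] := cov1 v ltac:(rank_lia); exists D => //; exact: st.
  have [/r_inj->|vc'] := eqVneq (r v) (r c); first by exists T => //; exact: st.
  by apply: cov; rank_lia.
(* Two kinds of edges belong to neither half and lie in [T]: from [c] to [b] or beyond, where [q] is
   [b] or a head of [ab], and from [a] to [c] or over it, where [q] is [c] or the upper end of a
   spanner. *)
move=> p q pq ltpq ap side.
have [pc|pc] := ltnP (r p) (r c); last first.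
  have [side'|side'] := boolP ((r c < r p) || (r q < r b)).
    by apply: edge => //; rank_lia.
  exists T; first exact: st.
  have /r_inj -> : r p = r c by rank_lia.
  rewrite cT /=; have [/r_inj->//|qb] := eqVneq (r q) (r b).
  by apply/hT/headsP; exists p => //; rank_lia.
have [E|pa] := eqVneq (r p) (r a); last first.
  have [D Dt1 H] := edge1 p q pq ltpq ltac:(rank_lia) ltac:(rank_lia).
  by exists D => //; exact: st.
have [qc|qc] := ltnP (r q) (r c).
  have [D Dt1 H] := edge1 p q pq ltpq ltac:(rank_lia) ltac:(rank_lia).
  by exists D => //; exact: st.
exists T; first exact: st.
rewrite (r_inj E) aT /=; have [/r_inj->//|qc'] := eqVneq (r q) (r c).
by apply: wT pq _ _; rank_lia.
Qed.

(** No edge crosses the chord between the lowest and highest vertices. Its root bag holds the edge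
    joining them, the only one that [refine_chord] leaves out. *)
Lemma treewidth_min_crossing : treewidth G <= 3 * k + 1.
Proof.
have [/existsP[x0 _]|/existsPn noG] := boolP [exists x : G, true]; last first.
  apply: (treewidth_le_bag_tree (bag_root set0)) => [v|v|B].
  - by have := noG v.
  - by have := noG v.
  - by rewrite inE => /eqP->; rewrite cards0.
have [a _ amin] := @arg_minnP _ x0 xpredT r isT.
have [b _ bmax] := @arg_maxnP _ x0 xpredT r isT.
have {}amin v : r a <= r v by exact: amin.
have {}bmax v : r v <= r b by exact: bmax.
have X0 : crossers r a b = set0.
  apply/setP => -[p q]; rewrite !inE /=; have := amin p; have := bmax q.
  by case: adj => //=; lia.
have h0 : heads a b = set0 by rewrite /heads X0 imset0.
have [||||||D v|t [[bt st] size_t _ cov edge]] :=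
  @refine_chord a b [:: [set a; b]] [set a; b] (bag_root _).
- by move=> D; rewrite inE => /eqP->; rewrite cards2; lia.
- by rewrite X0 cards0; lia.
- by rewrite inE.
- by rewrite !inE eqxx.
- by rewrite !inE eqxx orbT.
- by rewrite h0 sub0set.
- by rewrite inE => /eqP->; rewrite !inE => /orP[]/eqP->; lia.
have rootT : [set a; b] \in t by apply: st; rewrite inE.
have edges_ok p q : adj p q -> r p < r q ->
    exists2 D, D \in t & (p \in D) && (q \in D).
  move=> pq ltpq; have := amin p; have := bmax q => qb ap.
  have [side|] := boolP ((r a < r p) || (r q < r b)).
    by apply: edge => //; lia.
  move=> side; exists [set a; b] => //.
  have /r_inj -> : r p = r a by lia.
  have /r_inj -> : r q = r b by lia.
  by rewrite !inE !eqxx orbT.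
apply: (treewidth_le_bag_tree bt) => [v|u v uv|D /size_t]; last by lia.
- have [/r_inj->|va] := eqVneq (r v) (r a).
    by exists [set a; b] => //; rewrite !inE eqxx.
  have [/r_inj->|vb] := eqVneq (r v) (r b).
    by exists [set a; b] => //; rewrite !inE eqxx orbT.
  by apply: cov; have := amin v; have := bmax v; lia.
- case: (ltngtP (r u) (r v)) => [|/edges_ok|/r_inj E].
  + exact: edges_ok.
  + by rewrite adj_sym => /(_ uv)[D Dt]; rewrite andbC; exists D.
  + by move: uv; rewrite E adj_irr.
Qed.

End Refine.

(** * Linear order of points on a circle by stereographic projection *)

Section Circle.
Local Open Scope ring_scope.
Variable R : realType.

(* Stereographic coordinates on the circle of centre [c] through [c + d],
   with pole [c + d]; [d'] is [d] turned by a right angle. *)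
Definition stereo (c d d' : 'rV[R]_2) (t : R) : 'rV[R]_2 :=
  c + (((t ^+ 2 - 1) / (t ^+ 2 + 1)) *: d + ((2 * t) / (t ^+ 2 + 1)) *: d').

Lemma sqrD1_neq0 (t : R) : t ^+ 2 + 1 != 0.
Proof. by apply: lt0r_neq0; have := sqr_ge0 t; lra. Qed.

(** Scaled by [x ^+ 2 + 1], the point of parameter [x] is a linear image of [(1, x, x^2)]. The
    dependency of four such vectors has alternating signs, so it equates a convex combination of the
    points at [s], [u] with one of those at [t], [v]. *)
Lemma stereo_cross (c d d' : 'rV[R]_2) (s t u v : R) :
  s < t -> t < u -> u < v ->
  exists z, open_segment (stereo c d d' s) (stereo c d d' u) z /\
            open_segment (stereo c d d' t) (stereo c d d' v) z.
Proof.
move=> st tu uv.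
(* Coefficients of the affine dependency of four points (1, x, x^2) of the
   moment curve, read off the Vandermonde determinant. *)
pose ls := (u - t) * (v - u) * (v - t) * (s ^+ 2 + 1).
pose lu := (t - s) * (v - t) * (v - s) * (u ^+ 2 + 1).
pose lt := (u - s) * (v - u) * (v - s) * (t ^+ 2 + 1).
pose lv := (t - s) * (u - t) * (u - s) * (v ^+ 2 + 1).
have sq (x : R) : 0 < x ^+ 2 + 1 by have := sqr_ge0 x; lra.
have gs : 0 < ls by rewrite /ls !mulr_gt0 // subr_gt0; lra.
have gu : 0 < lu by rewrite /lu !mulr_gt0 // subr_gt0; lra.
have gt : 0 < lt by rewrite /lt !mulr_gt0 // subr_gt0; lra.
have gv : 0 < lv by rewrite /lv !mulr_gt0 // subr_gt0; lra.
have eqS : lt + lv = ls + lu by rewrite /ls /lu /lt /lv; ring.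
have frac (x y : R) : 0 < x -> 0 < y -> 0 < y / (x + y) < 1.
  by move=> x0 y0; rewrite divr_gt0 ?ltr_pdivrMr ?mul1r; lra.
exists ((1 - lu / (ls + lu)) *: stereo c d d' s
        + (lu / (ls + lu)) *: stereo c d d' u); split.
  by exists (lu / (ls + lu)); split=> //; exact: frac.
exists (lv / (lt + lv)); split; first exact: frac.
have nS : ls + lu != 0 by apply: lt0r_neq0; lra.
have e1 : 1 - lu / (ls + lu) = ls / (ls + lu) by field.
have e2 : 1 - lv / (ls + lu) = lt / (ls + lu) by rewrite -[lt](addrK lv) eqS; field.
rewrite eqS e1 e2; apply/rowP => i; rewrite !mxE; apply: (mulfI nS).
have e (w x : R) : (ls + lu) * (w / (ls + lu) * x) = w * x by field.
rewrite [LHS]mulrDr [RHS]mulrDr !e /ls /lu /lt /lv.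
by field; rewrite !sqrD1_neq0.
Qed.

Definition quarter_turn (d : 'rV[R]_2) : 'rV[R]_2 :=
  \row_i (if i == 0 then - d 0 1 else d 0 0).

Lemma on_circleE (c : 'rV[R]_2) (r : R) p : on_circle c r p <->
  (p 0 0 - c 0 0) ^+ 2 + (p 0 1 - c 0 1) ^+ 2 = r ^+ 2.
Proof.
rewrite /on_circle big_ord_recl big_ord1.
by have -> : lift ord0 ord0 = 1 :> 'I_2 by exact: val_inj.
Qed.

Lemma row2P (u v : 'rV[R]_2) : u 0 0 = v 0 0 -> u 0 1 = v 0 1 -> u = v.
Proof.
move=> e0 e1; apply/rowP => -[[|[|//]] i].
  by rewrite (_ : Ordinal i = 0) //; apply: val_inj.
by rewrite (_ : Ordinal i = 1) //; apply: val_inj.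
Qed.

Lemma stereo_surj (c d p : 'rV[R]_2) (r : R) :
  on_circle c r (c + d) -> on_circle c r p -> p != c + d ->
  exists t, p = stereo c d (quarter_turn d) t.
Proof.
move=> /on_circleE + /on_circleE + npd.
rewrite !mxE; set a := d 0 0; set b := d 0 1.
have -> : c 0 0 + a - c 0 0 = a by ring.
have -> : c 0 1 + b - c 0 1 = b by ring.
set x := p 0 0 - c 0 0; set y := p 0 1 - c 0 1 => ab xy.
(* Half the squared distance from [p] to the pole [c + d], hence nonzero. *)
pose D := r ^+ 2 - (a * x + b * y).
have D2 : D *+ 2 = (x - a) ^+ 2 + (y - b) ^+ 2.
  by rewrite /D mulr2n -{1}ab -xy; ring.
have D0 : D != 0.
  apply: contra_neq npd => D0; move: D2; rewrite D0 mul0rn => /esym/eqP.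
  rewrite paddr_eq0 ?sqr_ge0 // !sqrf_eq0 !subr_eq0 => /andP[/eqP xa /eqP yb].
  apply: row2P; rewrite !mxE -/a -/b -?xa -?yb /x /y; ring.
(* The cotangent of half the angle from [d] to [p - c]; [c0] and [c1] then recover the cosine and
   sine of that angle. *)
pose t := (a * y - b * x) / D.
have tD : (a * y - b * x) ^+ 2 + D ^+ 2 = D * r ^+ 2 *+ 2.
  suff -> : (a * y - b * x) ^+ 2 = r ^+ 2 * r ^+ 2 - (a * x + b * y) ^+ 2.
    by rewrite /D; ring.
  by rewrite -{1}ab -xy; ring.
have r0 : r ^+ 2 != 0.
  apply: contra_neq D0 => r0; apply/eqP; rewrite -sqrf_eq0; apply/eqP.
  have := tD; rewrite r0 mulr0 mul0rn => /eqP.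
  by rewrite paddr_eq0 ?sqr_ge0 // => /andP[_ /eqP].
have rn : r != 0 by move: r0; rewrite sqrf_eq0.
have t1 : t ^+ 2 + 1 = r ^+ 2 *+ 2 / D.
  apply: (mulfI (mulf_neq0 D0 D0)); rewrite /t.
  transitivity ((a * y - b * x) ^+ 2 + D ^+ 2); first by field.
  by rewrite tD; field.
have c1 : (2 * t) / (t ^+ 2 + 1) = (a * y - b * x) / r ^+ 2.
  by rewrite t1 /t; field; rewrite ?D0 ?rn.
have c0 : (t ^+ 2 - 1) / (t ^+ 2 + 1) = (a * x + b * y) / r ^+ 2.
  have -> : t ^+ 2 - 1 = (t ^+ 2 + 1) - 2 by ring.
  rewrite t1.
  transitivity ((r ^+ 2 - D) / r ^+ 2); first by field; rewrite ?D0 ?rn.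
  by congr (_ / _); rewrite /D; ring.
exists t; rewrite /stereo c0 c1.
apply: row2P; rewrite !mxE /= -/a -/b; apply: (mulfI r0).
  transitivity (r ^+ 2 * c 0 0 + ((a * x + b * y) * a - (a * y - b * x) * b));
    last by field.
  transitivity (r ^+ 2 * c 0 0 + (a ^+ 2 + b ^+ 2) * x); last by ring.
  by rewrite ab /x; ring.
transitivity (r ^+ 2 * c 0 1 + ((a * x + b * y) * b + (a * y - b * x) * a));
  last by field.
transitivity (r ^+ 2 * c 0 1 + (a ^+ 2 + b ^+ 2) * y); last by ring.
by rewrite ab /y; ring.
Qed.

Lemma on_circle_stereo (c d : 'rV[R]_2) (r t : R) : on_circle c r (c + d) ->
  on_circle c r (stereo c d (quarter_turn d) t).
Proof.
move=> /on_circleE ab; apply/on_circleE; move: ab.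
rewrite !mxE /= => <-; field; exact: sqrD1_neq0.
Qed.

(** Pigeonhole: the circle contains [#|T| + 1] distinct points [g i], and [f] cannot hit them
    all. *)
Lemma circle_avoid (T : finType) (f : T -> 'rV[R]_2) (c : 'rV[R]_2) (r : R) :
  0 < r -> exists2 d, on_circle c r (c + d) & forall x, f x != c + d.
Proof.
move=> r0; pose d0 : 'rV[R]_2 := \row_i (if i == 0 then r else 0).
have d0P : on_circle c r (c + d0).
  by apply/on_circleE; rewrite !mxE /=; ring.
pose g (n : nat) := stereo c d0 (quarter_turn d0) n%:R.
have g_inj : injective g.
  move=> m n /rowP e; have := e 0; have := e 1; rewrite !mxE /= => /addrI + /addrI.
  rewrite !(mulr0, addr0, oppr0, add0r) => e1 e0.
  have nz (i : nat) : (i%:R : R) ^+ 2 + 1 != 0 := sqrD1_neq0 _.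
  have r_neq0 : r != 0 by apply: lt0r_neq0.
  move/(mulIf r_neq0): e0 => e0; move/(mulIf r_neq0): e1 => e1.
  have inv (i : nat) : ((i%:R : R) ^+ 2 - 1) / (i%:R ^+ 2 + 1) = 1 - 2 / (i%:R ^+ 2 + 1).
    by field; exact: nz.
  (* The first coordinate determines [n ^+ 2 + 1], after which the second determines [n]. *)
  move: e0; rewrite !inv => /addrI/oppr_inj/(mulfI (_ : 2 != 0)) e0.
  move: e1; rewrite e0 ?pnatr_eq0 // => /(mulIf (invr_neq0 (nz n))).
  by move/(mulfI (_ : 2 != 0)); rewrite ?pnatr_eq0 // => /(_ isT)/eqP; rewrite eqr_nat => /eqP.
apply: contrapT => no_d.
have hit (i : 'I_#|T|.+1) : exists x, f x = g i.
  apply: contrapT => no_x; apply: no_d; exists (g i - c).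
    by rewrite addrC subrK; exact: on_circle_stereo.
  by move=> x; rewrite addrC subrK; apply/eqP => e; apply: no_x; exists x.
have [h hP] := choice hit.
have h_inj : injective h.
  by move=> i j e; apply/ord_inj/g_inj; rewrite -!hP e.
by have := leq_card h h_inj; rewrite card_ord ltnn.
Qed.

(** Projection from a point of the circle that carries no vertex cuts the circle open into a
    line. *)
Lemma convex_drawing_order (G : sgraph) (pos : G -> 'rV[R]_2) :
  convex_drawing pos ->
  exists2 t : G -> R, injective t &
    forall u v p q, t u < t p -> t p < t v -> t v < t q ->
      exists z, open_segment (pos u) (pos v) z /\ open_segment (pos p) (pos q) z.
Proof.
move=> [pos_inj [c [r [r0 circ]]]].
have [d dP avoid] := circle_avoid pos c r0.
have [t tP] := choice (fun v => stereo_surj dP (circ v) (avoid v)).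
exists t => [u v e|u v p q]; first by apply: pos_inj; rewrite !tP e.
by rewrite !tP; exact: stereo_cross.
Qed.

End Circle.

(** * From the drawing to ranks *)

Section Rank.
Variables (R : realType) (G : sgraph) (t : G -> R).
Hypothesis t_inj : injective t.

Definition rank (v : G) : nat := #|[set u | (t u < t v)%R]|.

Lemma ltn_rank u v : (rank u < rank v) = (t u < t v)%R.
Proof.
have mono x y : (t x <= t y)%R -> rank x <= rank y.
  move=> xy; apply/subset_leq_card/subsetP => z; rewrite !inE => zx.
  exact: lt_le_trans xy.
have [uv|/mono] := ltP (t u) (t v); last by rewrite leqNgt => /negbTE.
apply/proper_card/properP; split; last by exists u; rewrite !inE ?uv ?ltxx.
by apply/subsetP => z; rewrite !inE => zu; exact: lt_trans uv.
Qed.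

Lemma rank_inj : injective rank.
Proof.
move=> u v e; apply: t_inj; apply/eqP; rewrite eq_le !leNgt -!ltn_rank e.
by rewrite ltnn.
Qed.

End Rank.

Lemma card_crossers_le_crossing_number (R : realType) (G : sgraph)
    (pos : G -> 'rV[R]_2) (r : G -> nat) (u v : G) :
  (forall u v p q, r u < r p -> r p < r v -> r v < r q ->
     exists z, open_segment (pos u) (pos v) z /\ open_segment (pos p) (pos q) z) ->
  #|crossers r u v| <= crossing_number pos [set u; v].
Proof.
move=> meet; rewrite /crossing_number.
(* A crosser lists its endpoint of lower rank first, so the set of endpoints determines the pair. *)
have inj : {in crossers r u v &, injective (fun e : G * G => [set e.1; e.2])}.
  move=> [p q] [p' q']; rewrite !inE /= => /andP[_ H] /andP[_ H'] e.
  have : p \in [set p'; q'] by rewrite -e !inE eqxx.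
  have : q \in [set p'; q'] by rewrite -e !inE eqxx orbT.
  rewrite !inE => /orP[]/eqP eq /orP[]/eqP ep; subst p q => //; lia.
rewrite -(card_in_imset inj); apply/subset_leq_card/subsetP => _ /imsetP[[p q] + ->].
rewrite !inE /= => /andP[pq H]; apply/andP; split.
  by apply/imsetP; exists (p, q); rewrite ?inE.
apply/asboolP; split.
  move=> e; have : p \in [set u; v] by rewrite e !inE eqxx.
  by rewrite !inE => /orP[]/eqP ep; subst p; lia.
have [/and3P[up pv vq]|/and3P[pu uq qv]] := orP H.
  have [z [zuv zpq]] := meet _ _ _ _ up pv vq.
  by exists z; split; [exists u, v|exists p, q].
have [z [zpq zuv]] := meet _ _ _ _ pu uq qv.
by exists z; split; [exists u, v|exists p, q].
Qed.

Theorem theorem14 (R : realType) (k : nat) (hk : (1 <= k)%N) (G : sgraph)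
    (hG : outer_min_planar R G k) : (treewidth G <= 3 * k + 1)%N.
Proof.
have [pos [drawing min_k]] := hG.
have [t t_inj meet_t] := convex_drawing_order drawing.
have meet u v p q : rank t u < rank t p -> rank t p < rank t v ->
    rank t v < rank t q ->
    exists z, open_segment (pos u) (pos v) z /\ open_segment (pos p) (pos q) z.
  by rewrite !ltn_rank; exact: meet_t.
apply: (treewidth_min_crossing (rank_inj t_inj) hk) => u v p q uv pq.
move=> /andP[up pv] vq.
have edgeP x y : adj x y -> [set x; y] \in edges G.
  by move=> xy; apply/imsetP; exists (x, y); rewrite ?inE.
have cross : crossing pos [set u; v] [set p; q].
  split.
    move=> e; have : u \in [set p; q] by rewrite -e !inE eqxx.
    by rewrite !inE => /orP[]/eqP eu; subst u; lia.
  have [z [zuv zpq]] := meet _ _ _ _ up pv vq.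
  by exists z; split; [exists u, v|exists p, q].
have [le_k|le_k] := min_k _ _ (edgeP _ _ uv) (edgeP _ _ pq) cross; [left|right];
  exact: leq_trans (card_crossers_le_crossing_number _ _ meet) le_k.
Qed.
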